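(* Let $x$ be fixed observed data, $p(x,z)$, $z\in\mathbb{R}^d$, a positive joint density differentiable in $z$, with $p(x):=\int p(x,z)\,dz$, and let $q$ be a probability density on $\mathbb{R}^d$; set $w(z):=p(x,z)/q(z)$. Fix a point $z\in\mathbb{R}^d$ and a coordinate $i\in\{1,\dots,d\}$. For integers $M,K\ge 1$ let $\{z_{m,j}: 1\le m\le M,\ 1\le j\le K-1\}$ be i.i.d. with law $q$ and define the Monte Carlo estimator $$g^{i}_{M,K}(z):=\frac1M\sum_{m=1}^M\left(\frac{w(z)}{\sum_{j=1}^{K-1}w(z_{m,j})+w(z)}\right)^2\frac{\partial}{\partial z_i}\log w(z),$$ and $\mathrm{SNR}(g^i_{M,K}(z)):=|\mathbb{E}[g^i_{M,K}(z)]|/\sqrt{\mathbb{V}[g^i_{M,K}(z)]}$. Assume (i) $\mathbb{E}_{Z\sim q}[w(Z)^4]<\infty$ and (ii) $\mathbb{E}_{Z\sim q}[w(Z)^{-12}]<\infty$. Then, for any $z$ with $w(z)>0$, $$\mathrm{SNR}(g^i_{M,K}(z))=\Omega(\sqrt{MK}).$$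
   Context: For positive quantities $a$ and $b$, $a=\Omega(b)$ means there is a constant $c>0$ with $a/b\ge c$ for all $K$ sufficiently large. The estimator is the Monte Carlo estimate of the $i$-th coordinate of the Wasserstein gradient of the importance-weighted ELBO, $\mathbb{E}_{z_1,\dots,z_{K-1}\overset{i.i.d.}{\sim}q}\big[(w(z)/(\sum_{j=1}^{K-1}w(z_j)+w(z)))^2\nabla_z\log w(z)\big]$. *)

(* Defs.v *)
From HB Require Import structures.
From mathcomp Require Import all_boot all_order all_algebra.
From mathcomp Require Import all_classical all_reals all_analysis.
Set Implicit Arguments. Unset Strict Implicit. Unset Printing Implicit Defensive.
Import Order.TTheory GRing.Theory Num.Theory.
Import numFieldNormedType.Exports.
Local Open Scope classical_set_scope.
Local Open Scope ring_scope.

(* Iterated Lebesgue integral over R^n (represented as n.-tuple R, with its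
   product sigma-algebra): int dz_1 ... int dz_n f(z_1,...,z_n).
   For nonnegative measurable f this is the integral w.r.t. the Lebesgue
   measure on R^n (Tonelli). *)
Fixpoint iter_leb {R : realType} (n : nat) :
    (n.-tuple R -> \bar R) -> \bar R :=
  match n return (n.-tuple R -> \bar R) -> \bar R with
  | 0 => fun f => f [tuple]
  | n'.+1 => fun f =>
      (\int[@lebesgue_measure R]_t iter_leb (fun z => f (cons_tuple t z)))%E
  end.

Definition has_density {R : realType} (d : nat)
    (Q : probability (d.-tuple R) R) (q : d.-tuple R -> R) : Prop :=
  (forall z, 0 <= q z) /\
  forall A : set (d.-tuple R), measurable A ->
    Q A = iter_leb (fun z => (\1_A z * q z)%:E).

(* Identification of R^d as a row vector (normed space) and as a tuple
   (measurable space). *)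
Definition rv2t {R : realType} (d : nat) (v : 'rV[R]_d) : d.-tuple R :=
  [tuple v ord0 j | j < d].
Definition t2rv {R : realType} (d : nat) (z : d.-tuple R) : 'rV[R]_d :=
  \row_j tnth z j.

Definition partial {R : realType} (d : nat) (i : 'I_d)
    (f : d.-tuple R -> R) (z : d.-tuple R) : R :=
  derive (fun v => f (rv2t v)) (t2rv z) (delta_mx 0 i).

Definition iid_family {R : realType} {dO dT : measure_display}
    {Omega : measurableType dO} {T : measurableType dT} {I : finType}
    (P : probability Omega R) (Z : I -> Omega -> T) (Q : probability T R)
    : Prop :=
  (forall k, measurable_fun setT (Z k)) /\
  (forall k (A : set T), measurable A -> P (Z k @^-1` A) = Q A) /\
  (forall (J : {set I}) (A : I -> set T), (forall k, measurable (A k)) ->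
     P [set om | forall k, k \in J -> A k (Z k om)]
     = (\prod_(k in J) P (Z k @^-1` A k))%E).

Definition weight {R : realType} (d : nat) (px q : d.-tuple R -> R)
    (z : d.-tuple R) : R := px z / q z.

Definition estimator {R : realType} {dO : measure_display}
    {Omega : measurableType dO} (d : nat) (i : 'I_d)
    (px q : d.-tuple R -> R) (z : d.-tuple R) (M K : nat)
    (Z : 'I_M * 'I_K.-1 -> Omega -> d.-tuple R) : Omega -> R :=
  fun om => M%:R^-1 * \sum_(m < M)
    (weight px q z / (\sum_(j < K.-1) weight px q (Z (m, j) om)
                      + weight px q z)) ^+ 2
    * partial i (fun y => ln (weight px q y)) z.

(* Main.v *)
Require Import Defs.
From HB Require Import structures.
From mathcomp Require Import all_boot all_order all_algebra.
From mathcomp Require Import all_classical all_reals all_analysis.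
From mathcomp Require Import measurable_realfun ring lra.
Import Order.TTheory GRing.Theory Num.Theory.
Import numFieldNormedType.Exports.
Local Open Scope classical_set_scope.
Local Open Scope ring_scope.

Set Implicit Arguments.
Unset Strict Implicit.
Unset Printing Implicit Defensive.

(** Write W = w(Z), a = w(z), S_n for a sum of n i.i.d. copies of W (n = K - 1)
and f(s) = (s + a)^-2, so that up to a constant factor the estimator is the
average of M independent copies of f(S_n).  As f is convex,
E f(S_n) >= f(n E W), which is of order n^-2.  It remains to show that
Var f(S_n) = O(n^-5).  Conditioning on the first summand gives
  Var f(s + S_(n+1)) = E Var(f(s + W + S_n) | W) + Var (E[f(s + W + S_n) | W]),
and s |-> E f(s + S_n) decreases at rate at most 2 E (s + a + S_n)^-3, so the
last term is at most 4 E W^2 E (s + a + S_n)^-6.  By induction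
Var f(S_(n+1)) <= 4 (n + 1) E W^2 E (a + S_n)^-6, and convexity of x^-6 bounds
E (a + S_n)^-6 by (n + 1)^-7 (a^-6 + n E W^-6).  Only the moments of W of
order 2 and -6 matter.

The quantities E h(s + S_n) are iterates of the operator h |-> E h(. + W), so
that this part of the argument takes place under the law of a single W. *)

(** * Measurability of inversion; bounded nonnegative functions *)

Lemma measurable_funV d (T : measurableType d) (R : realType) (f : T -> R) :
  measurable_fun setT f -> measurable_fun setT (fun x => (f x)^-1).
Proof.
move=> mf; apply: (@measurableT_comp _ _ _ _ _ _ (@GRing.inv R)) => //.
(* Inversion is continuous on the open set of nonzero reals; the point 0, with its default value 0,
   is split off. *)
rewrite (_ : @GRing.inv R = fun x => if x == 0 then 0 else x^-1); last first.
  by apply/funext => x; case: eqP => // ->; rewrite invr0.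
apply: measurable_fun_if => //=.
  exact: measurable_fun_eqr.
rewrite setTI.
apply: open_continuous_measurable_fun.
  rewrite (_ : _ @^-1` _ = [set x : R | x != 0]); first exact: open_neq.
  by apply/seteqP; split => x /=; [move/negbT|move/negbTE].
move=> x; rewrite inE/= => /negbT x0; exact: continuousV.
Qed.

(** Such functions are integrable under every probability measure and stable under averaging, so
    this one predicate settles the side conditions of linearity, monotonicity and Tonelli. *)
Definition bounded_ge0 d (T : measurableType d) (R : realType) (f : T -> R) :=
  measurable_fun setT f /\ exists B, forall x, 0 <= f x <= B.

Lemma bounded_ge0_integrable d (T : measurableType d) (R : realType)
    (P : probability T R) (f : T -> R) :
  bounded_ge0 f -> P.-integrable setT (EFin \o f).
Proof.
move=> [mf [B fB]].
have Pfin : (P setT < +oo)%E by rewrite probability_setT ltry.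
apply: measurable_bounded_integrable => //.
rewrite /bounded_near; near=> M => x _ /=; have /andP[f0 fxB] := fB x.
rewrite ger0_norm//; apply: (le_trans fxB).
by near: M; apply: nbhs_pinfty_ge; exact: num_real.
Unshelve. all: by end_near. Qed.

Lemma Rintegral_prob_cst d (T : measurableType d) (R : realType)
    (P : probability T R) (c : R) : \int[P]_(_ in setT) c = c.
Proof. by rewrite Rintegral_cst// [X in fine X](probability_setT P)/= mulr1. Qed.


(** * Powers of inverses *)

Section inverse_power_inequalities.
Variable R : realFieldType.
Implicit Types x c b u v m : R.

(** The left side is the tangent to [x ^- 2] at [c], and the difference has a double zero at
    [x = c]. Integrating the tangent gives Jensen's inequality. *)
Lemma tangent_inv_sqr x c : 0 < x -> 0 < c ->
  c ^- 2 * (3 - 2 * (x / c)) <= x ^- 2.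
Proof.
move=> x0 c0; rewrite -subr_ge0.
rewrite (_ : _ - _ = (x / c - 1) ^+ 2 * (2 * (x / c) + 1) / x ^+ 2); last first.
  by field; rewrite !gt_eqF.
have t0 : 0 < x / c by rewrite divr_gt0.
by rewrite divr_ge0 ?sqr_ge0// mulr_ge0 ?sqr_ge0//; lra.
Qed.

Lemma tangent_inv_pow6 x c : 0 < x -> 0 < c ->
  c ^- 6 * (7 - 6 * (x / c)) <= x ^- 6.
Proof.
move=> x0 c0; rewrite -subr_ge0.
have t0 : 0 < x / c by rewrite divr_gt0.
rewrite (_ : _ - _ = (x / c - 1) ^+ 2 * (6 * (x / c) ^+ 5 + 5 * (x / c) ^+ 4
   + 4 * (x / c) ^+ 3 + 3 * (x / c) ^+ 2 + 2 * (x / c) + 1) / x ^+ 6); last first.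
  by field; rewrite !gt_eqF.
rewrite divr_ge0 ?exprn_ge0 ?(ltW x0)// mulr_ge0 ?sqr_ge0//.
by rewrite !addr_ge0// mulr_ge0// ?exprn_ge0// (ltW t0).
Qed.

(** Convexity of the power -6 at the points [u / m] and [v] with weights [m] and 1: add the two
    tangent inequalities at the barycentre [c], where the tangent values sum to
    [(m + 1) * c ^- 6]. *)
Lemma convex_inv_pow6 u v m : 0 < u -> 0 < v -> 0 < m ->
  (m + 1) ^+ 7 * (u + v) ^- 6 <= m ^+ 7 * u ^- 6 + v ^- 6.
Proof.
move=> u0 v0 m0; set c := (u + v) / (m + 1).
have m10 : 0 < m + 1 by rewrite addr_gt0.
have uv0 : 0 < u + v by rewrite addr_gt0.
have c0 : 0 < c by rewrite divr_gt0.
have := lerD (ler_wpM2l (ltW m0) (tangent_inv_pow6 (divr_gt0 u0 m0) c0))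
  (tangent_inv_pow6 v0 c0).
rewrite [leLHS](_ : _ = (m + 1) ^+ 7 * (u + v) ^- 6); last first.
  by rewrite /c; field; rewrite !gt_eqF.
rewrite [leRHS](_ : _ = m ^+ 7 * u ^- 6 + v ^- 6)//.
by field; rewrite !gt_eqF.
Qed.

(** The graph of the convex function [x ^- 2] lies above its tangent at [x], of slope
    [- 2 * x ^- 3]. *)
Lemma inv_sqr_sub_le x b : 0 < x -> 0 <= b ->
  x ^- 2 <= (x + b) ^- 2 + 2 * b * x ^- 3.
Proof.
move=> x0 b0; rewrite -subr_ge0.
have xb0 : 0 < x + b by rewrite ltr_wpDr.
rewrite (_ : _ - _ = b ^+ 2 * (3 * x + 2 * b) / (x ^+ 3 * (x + b) ^+ 2)); last first.
  by field; rewrite !gt_eqF.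
rewrite divr_ge0// mulr_ge0 ?sqr_ge0 ?exprn_ge0 ?(ltW x0)//; lra.
Qed.

End inverse_power_inequalities.

(** * Sums of i.i.d. variables as iterated integrals *)

Section smooth.
Context d (T : measurableType d) (R : realType) (Q : probability T R).
Variable w : T -> R.
Hypotheses (mw : measurable_fun setT w) (w_ge0 : forall y, 0 <= w y).

(* [iter n smooth h s] is E h(s + W_1 + ... + W_n) for i.i.d. W_k of law w(Q). *)
Definition smooth (h : R -> R) (s : R) : R := \int[Q]_y h (s + w y).

Lemma bounded_ge0_shift (h : R -> R) s :
  bounded_ge0 h -> bounded_ge0 (fun y => h (s + w y)).
Proof.
move=> [mh [B hB]]; split; last by exists B.
by apply: measurableT_comp => //; apply: measurable_funD.
Qed.

Lemma smooth_integrable (h : R -> R) s :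
  bounded_ge0 h -> Q.-integrable setT (EFin \o (fun y => h (s + w y))).
Proof. by move=> bh; exact/bounded_ge0_integrable/bounded_ge0_shift. Qed.

Lemma bounded_ge0_smooth (h : R -> R) : bounded_ge0 h -> bounded_ge0 (smooth h).
Proof.
move=> bh; have [mh [B hB]] := bh; split.
  apply: (@measurableT_comp _ _ _ _ _ _ (@fine R)) => //.
  apply: (@measurable_fun_fubini_tonelli_F _ _ _ _ _ Q
      (fun p : R * T => (h (p.1 + w p.2))%:E)).
    apply/measurable_EFinP; apply: measurableT_comp => //.
    by apply: measurable_funD => //; exact: measurableT_comp.
  by move=> p; rewrite lee_fin; have /andP[] := hB (p.1 + w p.2).
exists B => s; rewrite Rintegral_ge0 => [/=|y _]; last first.
  by have /andP[] := hB (s + w y).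
rewrite -[leRHS](Rintegral_prob_cst Q); apply: le_Rintegral => //.
- exact: smooth_integrable.
- exact: finite_measure_integrable_cst.
- by move=> y _; have /andP[] := hB (s + w y).
Qed.

Lemma bounded_ge0_iter_smooth n (h : R -> R) :
  bounded_ge0 h -> bounded_ge0 (iter n smooth h).
Proof. by move=> bh; elim: n => //= n; exact: bounded_ge0_smooth. Qed.

Lemma le_smooth (h k : R -> R) s : bounded_ge0 h -> bounded_ge0 k ->
  (forall x, s <= x -> h x <= k x) -> smooth h s <= smooth k s.
Proof.
move=> bh bk hk; apply: le_Rintegral => //; try exact: smooth_integrable.
by move=> y _; apply: hk; rewrite lerDl.
Qed.


(** * Comparison of integrals, squared deviations and Jensen's inequality *)

Let bint := @bounded_ge0_integrable _ _ _ Q.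

Lemma integrable_EFinD (f g : T -> R) :
  Q.-integrable setT (EFin \o f) -> Q.-integrable setT (EFin \o g) ->
  Q.-integrable setT (EFin \o (fun y => f y + g y)).
Proof. by move=> fi gi; exact: (integrableD measurableT fi gi). Qed.

Lemma integrable_EFinZ (f : T -> R) k :
  Q.-integrable setT (EFin \o f) ->
  Q.-integrable setT (EFin \o (fun y => k * f y)).
Proof. by move=> fi; exact: (integrableZl measurableT k fi). Qed.

Lemma integrable_EFin_cst (k : R) : Q.-integrable setT (EFin \o (fun=> k)).
Proof. exact: finite_measure_integrable_cst. Qed.

(** Comparison outside a null set is what bounds by [w y ^- 6] require: where [w] vanishes, this
    power has the default value 0. *)
Lemma ae_le_Rintegral (f g : T -> R) :
  Q.-integrable setT (EFin \o f) -> Q.-integrable setT (EFin \o g) ->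
  (forall y, 0 <= f y) -> (forall y, 0 <= g y) ->
  {ae Q, forall y, f y <= g y} -> \int[Q]_y f y <= \int[Q]_y g y.
Proof.
move=> fi gi f0 g0 fg; rewrite /Rintegral fine_le//.
- exact: integrable_fin_num.
- exact: integrable_fin_num.
- apply: ae_ge0_le_integral => //.
  + by move=> y _; rewrite lee_fin.
  + exact: measurable_int fi.
  + by move=> y _; rewrite lee_fin.
  + exact: measurable_int gi.
  + by apply: filterS fg => y fgy _; rewrite lee_fin.
Qed.

Lemma bounded_ge0_sqr d' (T' : measurableType d') (f : T' -> R) :
  bounded_ge0 f -> bounded_ge0 (fun y => f y ^+ 2).
Proof.
move=> [mf [B fB]]; split; first exact: measurable_funX.
exists (B ^+ 2) => y; have /andP[f0 fyB] := fB y.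
by rewrite sqr_ge0/= lerXn2r// nnegrE// (le_trans f0).
Qed.

(** The centre [c] is free: the mean as centre gives Jensen's inequality and the variance, any other
    centre bounds the variance from above. *)
Lemma Rintegral_sqr_dev (f : T -> R) (c : R) : bounded_ge0 f ->
  \int[Q]_y (f y - c) ^+ 2 = \int[Q]_y (f y) ^+ 2 - 2 * c * \int[Q]_y f y + c ^+ 2.
Proof.
move=> bf.
rewrite (@eq_Rintegral _ _ _ Q _ (fun y => (f y ^+ 2 + (- (2 * c)) * f y) + c ^+ 2));
  last by move=> y _; ring.
have i1 := bint (bounded_ge0_sqr bf).
have i2 := integrable_EFinZ (- (2 * c)) (bint bf).
rewrite RintegralD//; last 2 first.
- exact: integrable_EFinD.
- exact: integrable_EFin_cst.
rewrite RintegralD// Rintegral_prob_cst RintegralZl//; last exact: bint.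
by rewrite mulNr.
Qed.

Lemma integrable_sqr_dev (f : T -> R) (c : R) : bounded_ge0 f ->
  Q.-integrable setT (EFin \o (fun y => (f y - c) ^+ 2)).
Proof.
move=> bf; rewrite (_ : (fun _ => _) =
    fun y => (f y ^+ 2 + (- (2 * c)) * f y) + c ^+ 2); last first.
  by apply/funext => y; ring.
apply: integrable_EFinD; last exact: integrable_EFin_cst.
apply: integrable_EFinD; first exact/bint/bounded_ge0_sqr.
exact/integrable_EFinZ/bint.
Qed.

Lemma sqr_smooth_le (h : R -> R) s : bounded_ge0 h ->
  (smooth h s) ^+ 2 <= smooth (fun x => h x ^+ 2) s.
Proof.
move=> bh; have bs := bounded_ge0_shift s bh.
have : 0 <= \int[Q]_y (h (s + w y) - smooth h s) ^+ 2.
  by apply: Rintegral_ge0 => y _; exact: sqr_ge0.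
rewrite Rintegral_sqr_dev// -/(smooth h s) -/(smooth (fun x => h x ^+ 2) s).
nra.
Qed.

Lemma iter_smooth_sqr_le n (h : R -> R) s : bounded_ge0 h ->
  (iter n smooth h s) ^+ 2 <= iter n smooth (fun x => h x ^+ 2) s.
Proof.
move=> bh; elim: n s => //= n IH s.
have bF := bounded_ge0_iter_smooth n bh.
apply: (le_trans (sqr_smooth_le s bF)); apply: le_smooth => //.
- exact: bounded_ge0_sqr.
- exact/bounded_ge0_iter_smooth/bounded_ge0_sqr.
Qed.

(* The absolute value only serves to make the function bounded on the whole
   line: it is used at nonnegative arguments. *)
Definition invpow (a : R) k (s : R) : R := (`|s| + a) ^- k.

Lemma bounded_ge0_invpow (a : R) k : 0 < a -> bounded_ge0 (invpow a k).
Proof.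
move=> a0; split.
  apply: measurable_funV; apply: measurable_funX; apply: measurable_funD => //.
exists (a ^- k) => s.
have ha : a <= `|s| + a by rewrite lerDr.
have h0 : 0 < `|s| + a by rewrite (lt_le_trans a0).
rewrite /invpow invr_ge0 exprn_ge0 ?(ltW h0)//=.
by rewrite lef_pV2 ?posrE ?exprn_gt0// lerXn2r// nnegrE ltW.
Qed.


(** * Inverse moments and variance of inverse squares *)

Hypotheses (a : R) (a_gt0 : 0 < a).

Let bip k : bounded_ge0 (invpow a k). Proof. exact: bounded_ge0_invpow. Qed.

Let bipn n k : bounded_ge0 (iter n smooth (invpow a k)).
Proof. exact: bounded_ge0_iter_smooth. Qed.

Lemma invpowE k s : 0 <= s -> invpow a k s = (s + a) ^- k.
Proof. by move=> s0; rewrite /invpow ger0_norm. Qed.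

Lemma iter_smooth_inv_sqr_ge n s :
  Q.-integrable setT (EFin \o w) -> 0 <= s ->
  (s + n%:R * \int[Q]_y w y + a) ^- 2 <= iter n smooth (invpow a 2) s.
Proof.
move=> iw; set mu := \int[Q]_y w y.
have mu0 : 0 <= mu by apply: Rintegral_ge0 => y _.
elim: n s => [|n IH] s s0; first by rewrite mul0r addr0/= invpowE.
have n0 : 0 <= n%:R * mu by rewrite mulr_ge0.
set c := s + _ + a.
have c0 : 0 < c.
  by rewrite /c ltr_wpDl// addr_ge0// mulr_ge0.
rewrite iterS.
(* [A + B * w y] is the tangent to [x ^- 2] at [c], taken at [s + w y + n%:R * mu + a]. The mean of
   this argument is [c], so the tangent integrates to [c ^- 2]. *)
pose A := c ^- 2 * (3 - 2 * ((s + n%:R * mu + a) / c)).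
pose B := - (2 * c ^- 3).
have -> : c ^- 2 = \int[Q]_y (A + B * w y).
  rewrite RintegralD//; [|exact: integrable_EFin_cst|exact: integrable_EFinZ].
  rewrite Rintegral_prob_cst RintegralZl// -/mu /A /B.
  have -> : s + n%:R * mu + a = c - mu by rewrite /c -natr1; ring.
  by field; rewrite gt_eqF.
apply: le_Rintegral => //.
- apply: integrable_EFinD; [exact: integrable_EFin_cst|exact: integrable_EFinZ].
- exact: smooth_integrable.
move=> y _; apply: le_trans (IH _ _); last by rewrite addr_ge0.
apply: le_trans (tangent_inv_sqr _ c0).
  by rewrite /A /B le_eqVlt; apply/orP; left; apply/eqP; field; rewrite gt_eqF.
by rewrite ltr_wpDl// !addr_ge0.
Qed.

(* The parameter [m] makes the induction work: [s + a] plays the role of a sum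
   of [m] earlier summands. *)
Lemma iter_smooth_inv_pow6_le n m s :
  Q.-integrable setT (EFin \o (fun y => w y ^- 6)) ->
  {ae Q, forall y, 0 < w y} -> 0 < m -> 0 <= s ->
  iter n smooth (invpow a 6) s <=
  (m ^+ 7 * (s + a) ^- 6 + n%:R * \int[Q]_y (w y ^- 6)) / (m + n%:R) ^+ 7.
Proof.
move=> iw w_gt0; set k := \int[Q]_y (w y ^- 6).
elim: n m s => [|n IH] m s m0 s0.
  rewrite mul0r !addr0/= invpowE// le_eqVlt; apply/orP; left; apply/eqP.
  by field; rewrite !gt_eqF// ltr_wpDl.
have n0 : 0 <= n%:R :> R by [].
have mn0 : 0 < m + n.+1%:R by rewrite ltr_wpDr.
pose A := (m ^+ 7 * (s + a) ^- 6 + n%:R * k) / (m + n.+1%:R) ^+ 7.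
pose B := (m + n.+1%:R) ^- 7.
have -> : (m ^+ 7 * (s + a) ^- 6 + n.+1%:R * k) / (m + n.+1%:R) ^+ 7 =
    \int[Q]_y (A + B * w y ^- 6).
  rewrite RintegralD//; [|exact: integrable_EFin_cst|exact: integrable_EFinZ].
  rewrite Rintegral_prob_cst RintegralZl// -/k /A /B -natr1.
  by ring.
have sa0 : 0 < s + a by rewrite ltr_wpDl.
have k0 : 0 <= k.
  by apply: Rintegral_ge0 => y _; rewrite invr_ge0 exprn_ge0.
rewrite iterS; apply: ae_le_Rintegral => //.
- exact: smooth_integrable.
- apply: integrable_EFinD; [exact: integrable_EFin_cst|exact: integrable_EFinZ].
- by move=> y; have [_ [M /(_ (s + w y))/andP[]]] := bipn n 6.
- move=> y; apply: addr_ge0.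
    apply: divr_ge0; last exact/exprn_ge0/ltW.
    by apply: addr_ge0; apply: mulr_ge0; rewrite ?invr_ge0 ?exprn_ge0// ltW.
  by apply: mulr_ge0; rewrite invr_ge0 exprn_ge0// ltW.
apply: filterS w_gt0 => y wy0.
have m10 : 0 < m + 1 by rewrite addr_gt0.
(* The new summand joins the earlier ones, so [m] becomes [m + 1] and the denominator is unchanged;
   convexity then separates [w y] from [s + a]. *)
apply: le_trans (IH (m + 1) _ m10 _) _; first by rewrite addr_ge0.
rewrite (_ : m + 1 + n%:R = m + n.+1%:R); last by rewrite -natr1; ring.
rewrite /A /B [B * _]mulrC -mulrDl ler_pM2r ?invr_gt0 ?exprn_gt0//.
rewrite [leRHS]addrAC lerD2r (_ : s + w y + a = (s + a) + w y); last by ring.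
exact: convex_inv_pow6.
Qed.

Lemma iter_smooth_inv_sqr_anti n s b : 0 <= s -> 0 <= b ->
  iter n smooth (invpow a 2) (s + b) <= iter n smooth (invpow a 2) s.
Proof.
move=> s0 b0; elim: n s s0 => [|n IH] s s0.
  rewrite /= !invpowE ?addr_ge0// lef_pV2 ?posrE ?exprn_gt0 ?ltr_wpDl ?addr_ge0//.
  by rewrite lerXn2r ?nnegrE ?addr_ge0 ?(ltW a_gt0)// lerD2r lerDl.
rewrite !iterS; apply: le_Rintegral => //; try exact: smooth_integrable.
by move=> y _; rewrite addrAC IH// addr_ge0.
Qed.

(** The case of no summands is the tangent bound at [s + a]; since [b] is fixed, averaging over one
    more summand preserves the inequality. *)
Lemma iter_smooth_inv_sqr_lip n s b : 0 <= s -> 0 <= b ->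
  iter n smooth (invpow a 2) s <=
  iter n smooth (invpow a 2) (s + b) + 2 * b * iter n smooth (invpow a 3) s.
Proof.
move=> s0 b0; elim: n s s0 => [|n IH] s s0.
  rewrite /= !invpowE ?addr_ge0// addrAC.
  by apply: inv_sqr_sub_le => //; rewrite ltr_wpDl.
rewrite !iterS {2 3}/smooth -RintegralZl//; last exact: smooth_integrable.
rewrite -RintegralD//; last 2 first.
- exact: smooth_integrable.
- exact/integrable_EFinZ/smooth_integrable.
apply: le_Rintegral => //; first exact: smooth_integrable.
  by apply: integrable_EFinD; [|apply: integrable_EFinZ]; exact: smooth_integrable.
by move=> y _; rewrite (addrAC s b) IH// addr_ge0.
Qed.

(** The variance of [F (s + W)] is at most its mean squared deviation from the constant [F s], and
    each deviation is at most [2 * W * X]. *)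
Lemma smooth_sqr_le (F : R -> R) (s X : R) : bounded_ge0 F -> 0 <= X ->
  Q.-integrable setT (EFin \o (fun y => w y ^+ 2)) ->
  (forall b, 0 <= b -> F (s + b) <= F s <= F (s + b) + 2 * b * X) ->
  smooth (fun x => F x ^+ 2) s <=
  (smooth F s) ^+ 2 + 4 * X ^+ 2 * \int[Q]_y (w y) ^+ 2.
Proof.
move=> bF X0 iw FX; have bs := bounded_ge0_shift s bF.
have : \int[Q]_y (F (s + w y) - F s) ^+ 2 <= \int[Q]_y (4 * X ^+ 2 * w y ^+ 2).
  apply: le_Rintegral => //.
  - exact: integrable_sqr_dev.
  - exact: integrable_EFinZ.
  move=> y _; have /andP[F1 F2] := FX (w y) (w_ge0 y).
  rewrite (_ : 4 * _ * _ = (2 * w y * X) ^+ 2); last by ring.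
  rewrite -sqrrN opprB lerXn2r// ?nnegrE ?subr_ge0 ?mulr_ge0//.
  by rewrite lerBlDl.
rewrite Rintegral_sqr_dev// RintegralZl// -/(smooth F s).
rewrite -/(smooth (fun x => F x ^+ 2) s).
by have := sqr_ge0 (smooth F s - F s); nra.
Qed.

Lemma iter_smooth_variance_le n s :
  Q.-integrable setT (EFin \o (fun y => w y ^+ 2)) -> 0 <= s ->
  iter n.+1 smooth (fun x => invpow a 2 x ^+ 2) s <=
  (iter n.+1 smooth (invpow a 2) s) ^+ 2 +
  n.+1%:R * (4 * \int[Q]_y (w y) ^+ 2) * iter n smooth (invpow a 6) s.
Proof.
move=> iw; set m2 := \int[Q]_y (w y) ^+ 2.
have m20 : 0 <= m2 by apply: Rintegral_ge0 => y _; exact: sqr_ge0.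
(* Variance of the conditional mean given the first summand: the rate of decrease involves the mean
   of the power -3, whose square is at most the mean of the power -6. *)
have step k t : 0 <= t ->
  smooth (fun x => iter k smooth (invpow a 2) x ^+ 2) t <=
  (iter k.+1 smooth (invpow a 2) t) ^+ 2 + 4 * m2 * iter k smooth (invpow a 6) t.
  move=> t0; apply: (le_trans (@smooth_sqr_le _ _ (iter k smooth (invpow a 3) t) _ _ _ _)) => //.
  - by have [_ [M /(_ t)/andP[]]] := bipn k 3.
  - by move=> b b0; rewrite iter_smooth_inv_sqr_anti//= iter_smooth_inv_sqr_lip.
  rewrite -/m2 lerD2l mulrAC ler_wpM2l ?mulr_ge0//.
  apply: (le_trans (iter_smooth_sqr_le _ _ _)) => //.
  rewrite (_ : (fun x => _) = invpow a 6)//.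
  by apply/funext => x; rewrite /invpow -exprVn -exprM exprVn.
elim: n s => [|n IH] s s0; first by rewrite mul1r; exact: (step 0).
have bG : bounded_ge0 (fun x => invpow a 2 x ^+ 2) by exact: bounded_ge0_sqr.
have bF := bipn n.+1 2.
(* Law of total variance: the induction hypothesis bounds the conditional second moment given [w y].
   Averaging it yields [n.+1] copies of the error term, and [step] contributes one more. *)
rewrite iterS; apply: (@le_trans _ _ (\int[Q]_y
   (iter n.+1 smooth (invpow a 2) (s + w y) ^+ 2 +
    n.+1%:R * (4 * m2) * iter n smooth (invpow a 6) (s + w y)))).
  apply: le_Rintegral => //.
  - exact/smooth_integrable/bounded_ge0_iter_smooth.
  - apply: integrable_EFinD; last exact/integrable_EFinZ/smooth_integrable.
    exact/(smooth_integrable (h := fun x => iter n.+1 smooth (invpow a 2) x ^+ 2))/bounded_ge0_sqr.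
  - by move=> y _; rewrite IH// addr_ge0.
rewrite RintegralD//; last 2 first.
- exact/(smooth_integrable (h := fun x => iter n.+1 smooth (invpow a 2) x ^+ 2))/bounded_ge0_sqr.
- exact/integrable_EFinZ/smooth_integrable.
rewrite RintegralZl//; last exact: smooth_integrable.
rewrite -/(smooth (iter n smooth (invpow a 6)) s) -iterS.
rewrite -/(smooth (fun x => iter n.+1 smooth (invpow a 2) x ^+ 2) s).
apply: (le_trans (lerD (step n.+1 s s0) (lexx _))).
by rewrite -[n.+2%:R]natr1 le_eqVlt; apply/orP; left; apply/eqP; ring.
Qed.

End smooth.

(** * Independence *)

Section independence.
Context d (T : measurableType d) (R : realType) (Q : probability T R).
Context dO (Omega : measurableType dO) (P : probability Omega R).
Context (I : finType) (Z : I -> Omega -> T).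

(** This encodes both independence of [V] from the [Z k] with [k] in [J] and their joint product
    law. [V] collects the variables already used; [J] indexes those still to be integrated out. *)
Definition indep_of d' (T' : measurableType d') (V : Omega -> T')
    (J : {set I}) :=
  forall (B : set T') (A : I -> set T),
    measurable B -> (forall k, measurable (A k)) ->
    P (V @^-1` B `&` [set om | forall k, k \in J -> A k (Z k om)]) =
    (P (V @^-1` B) * (\prod_(k in J) fine (Q (A k)))%:E)%E.

Hypothesis iid : iid_family P Z Q.

Lemma measurable_iid k : measurable_fun setT (Z k).
Proof. by case: iid. Qed.

Lemma measurable_iid_event (J : {set I}) (A : I -> set T) :
  (forall k, measurable (A k)) ->
  measurable [set om | forall k, k \in J -> A k (Z k om)].
Proof.
move=> mA.
rewrite (_ : [set _ | _] = \bigcap_(k in [set` J]) (Z k @^-1` A k))//.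
apply: fin_bigcap_measurable => // k _.
by rewrite -[X in measurable X]setTI; exact: measurable_iid.
Qed.

Lemma indep_of_cst d' (T' : measurableType d') (c : T') (J : {set I}) :
  indep_of (fun=> c) J.
Proof.
move=> B A mB mA; rewrite preimage_cst.
have [_ [idd ind]] := iid.
case: ifPn => cB; last by rewrite set0I !measure0 mul0e.
rewrite setTI probability_setT mul1e ind//.
rewrite -prodEFin; apply: eq_bigr => k _.
by rewrite idd// fineK// fin_num_measure.
Qed.

Lemma indep_of_comp d1 d2 (T1 : measurableType d1) (T2 : measurableType d2)
    (V : Omega -> T1) (g : T1 -> T2) (J : {set I}) :
  measurable_fun setT g -> indep_of V J -> indep_of (g \o V) J.
Proof.
move=> mg iV B A mB mA; rewrite comp_preimage iV//.
by rewrite -[X in measurable X]setTI; exact: mg.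
Qed.

(** Constrain [Z k] by [C] and leave the indices in [J] unconstrained. *)
Lemma indep_of_prod d' (T' : measurableType d') (V : Omega -> T') k B C
    (J : {set I}) :
  k \notin J -> indep_of V (k |: J)%SET -> measurable B -> measurable C ->
  P ((fun om => (V om, Z k om)) @^-1` (B `*` C)) =
  (P (V @^-1` B) * Q C)%E.
Proof.
move=> kJ iV mB mC.
have mA k' : measurable (if k' == k then C else setT) by case: ifP.
have := iV B _ mB mA; rewrite big_setU1//= eqxx big1 ?mulr1; last first.
  move=> k' k'J; case: eqP => [kk'|_]; first by rewrite kk' (negbTE kJ) in k'J.
  by rewrite probability_setT.
rewrite fineK ?fin_num_measure// => <-; congr (P _).
apply/seteqP; split => om /= [HB HC]; split => //.
  move=> k' _; by case: eqP => [->|].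
by have := HC k; rewrite setU11 eqxx; exact.
Qed.

(** This moves an index from the reserve into the collected variable. For a fixed event on [J], both
    sides are finite measures in [B] that agree on rectangles, a generating class closed under
    intersection. *)
Lemma indep_of_pair d' (T' : measurableType d') (V : Omega -> T') k
    (J : {set I}) : measurable_fun setT V ->
  k \notin J -> indep_of V (k |: J)%SET ->
  indep_of (fun om => (V om, Z k om)) J.
Proof.
move=> mV kJ iV B A mB mA.
set E := [set om | _].
have mE : measurable E by exact: measurable_iid_event.
have mVZ : measurable_fun setT (fun om => (V om, Z k om)).
  by apply: measurable_fun_pair => //; exact: measurable_iid.
pose F : {mfun Omega >-> (T' * T)%type} := mfun_Sub (mem_set mVZ).
pose m0 : {measure set Omega -> \bar R} := mrestr P mE.
pose m1 : {measure set (T' * T)%type -> \bar R} := pushforward m0 F.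
have r0 : 0 <= \prod_(k in J) fine (Q (A k)).
  by apply: prodr_ge0 => i _; apply: fine_ge0.
pose m2 : {measure set (T' * T)%type -> \bar R} :=
  mscale (NngNum r0) (distribution P F).
suff : m1 mVZ B = m2 B by rewrite /m1/= /m2/= /mscale/= muleC.
apply: (measure_unique [set A `*` B | A in measurable & B in measurable]
  (fun=> setT)) => //.
- exact: measurable_prod_measurableType.
- move=> _ _ [X1 mX1 [X2 mX2 <-]] [Y1 mY1 [Y2 mY2 <-]].
  rewrite -setXI; exists (X1 `&` Y1); first exact: measurableI.
  by exists (X2 `&` Y2) => //; exact: measurableI.
- by move=> _; exists setT => //; exists setT => //; rewrite setXTT.
- by rewrite bigcup_const.
- move=> _ [X mX [Y mY <-]].
  rewrite /m1/= /m2/= /mscale/= /pushforward /m0/= /mrestr.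
  have := indep_of_prod kJ iV mX mY; rewrite -[X in X = _]/(distribution P F (X `*` Y)) => ->.
  have mA' k' : measurable (if k' == k then Y else A k') by case: ifP.
  have := iV X _ mX mA'; rewrite big_setU1//= eqxx EFinM fineK ?fin_num_measure//.
  rewrite [X in _ = (_ * (_ * X%:E))%E -> _](_ : _ = \prod_(k in J) fine (Q (A k))); last first.
    apply: eq_bigr => k' k'J; case: eqP => // kk'.
    by rewrite kk' (negbTE kJ) in k'J.
  rewrite muleA [RHS]muleC => <-; congr (P _).
  apply/seteqP; split => om /=.
    move=> [[HX HY] HE]; split => // k'; rewrite !inE.
    case: eqP => [-> //|_ /=]; exact: HE.
  move=> [HX HE]; split; first split => //.
    by have := HE k; rewrite setU11 eqxx; exact.
  move=> k' k'J; have := HE k'; rewrite !inE k'J orbT => /(_ erefl).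
  by case: eqP => // kk'; rewrite kk' (negbTE kJ) in k'J.
- move=> _; rewrite /m1/= /pushforward /m0/= /mrestr preimage_setT setTI.
  by rewrite (le_lt_trans (probability_le1 P mE))// ltry.
Qed.

(** The law of the pair is the product of the law of [V] with [Q], so Tonelli integrates out
    [Z k]. *)
Lemma indep_of_integral d' (T' : measurableType d') (V : Omega -> T') k
    (J : {set I}) (h : T' * T -> R) : measurable_fun setT V ->
  k \notin J -> indep_of V (k |: J)%SET -> bounded_ge0 h ->
  \int[P]_om h (V om, Z k om) = \int[P]_om (\int[Q]_y h (V om, y)).
Proof.
move=> mV kJ iV bh; have [mh [M hM]] := bh.
have h0 x : (0 <= (h x)%:E)%E by rewrite lee_fin; have /andP[] := hM x.
have mhE : measurable_fun setT (EFin \o h) by exact/measurable_EFinP.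
have mVZ : measurable_fun setT (fun om => (V om, Z k om)).
  by apply: measurable_fun_pair => //; exact: measurable_iid.
pose F : {mfun Omega >-> (T' * T)%type} := mfun_Sub (mem_set mVZ).
pose V' : {mfun Omega >-> T'} := mfun_Sub (mem_set mV).
have bhV om : bounded_ge0 (fun y => h (V om, y)).
  split; first exact: measurable_fun_pair2.
  by exists M => y.
congr fine.
transitivity (\int[P]_om ((EFin \o h) \o F) om)%E; first by [].
rewrite -ge0_integral_distribution//.
rewrite (eq_measure_integral (distribution P V' \x Q)%E); last first.
  move=> A mA _; apply/esym; apply: product_measure_unique => // X Y mX mY.
  exact: (indep_of_prod kJ iV mX mY).
rewrite fubini_tonelli1// ge0_integral_distribution//; last first.
- by move=> y; rewrite /fubini_F; apply: integral_ge0 => t _; exact: h0.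
- exact: measurable_fun_fubini_tonelli_F.
apply: eq_integral => om _; rewrite /= /fubini_F /= /Rintegral fineK//.
exact/integrable_fin_num/bounded_ge0_integrable.
Qed.

End independence.

(** * Closure properties of bounded nonnegative functions *)

Lemma bounded_ge0M d (T : measurableType d) (R : realType) (f g : T -> R) :
  bounded_ge0 f -> bounded_ge0 g -> bounded_ge0 (fun x => f x * g x).
Proof.
move=> [mf [A fA]] [mg [B gB]]; split; first exact: measurable_funM.
exists (A * B) => x; have /andP[f0 fxA] := fA x; have /andP[g0 gxB] := gB x.
by rewrite mulr_ge0//= ler_pM.
Qed.

Lemma bounded_ge0_comp d d' (T : measurableType d) (T' : measurableType d')
    (R : realType) (f : T' -> R) (g : T -> T') :
  measurable_fun setT g -> bounded_ge0 f -> bounded_ge0 (fun x => f (g x)).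
Proof.
move=> mg [mf [B fB]]; split; first exact: measurableT_comp.
by exists B => x.
Qed.

Lemma bounded_ge0_sum d (T : measurableType d) (R : realType) (J : Type)
    (s : seq J) (f : J -> T -> R) :
  (forall j, bounded_ge0 (f j)) -> bounded_ge0 (fun x => \sum_(j <- s) f j x).
Proof.
move=> bf; split; first by apply: measurable_sum => j; have [] := bf j.
have /choice[B fB] : forall j, exists B, forall x, 0 <= f j x <= B.
  by move=> j; have [] := bf j.
exists (\sum_(j <- s) B j) => x; rewrite sumr_ge0/= => [|j _]; last first.
  by have /andP[] := fB j x.
by apply: ler_sum => j _; have /andP[] := fB j x.
Qed.

Lemma Rintegral_sum d (T : measurableType d) (R : realType)
    (P : probability T R) (J : Type) (s : seq J) (f : J -> T -> R) :
  (forall j, bounded_ge0 (f j)) ->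
  \int[P]_x (\sum_(j <- s) f j x) = \sum_(j <- s) \int[P]_x f j x.
Proof.
move=> bf; elim: s => [|j s IH].
  by under eq_Rintegral do rewrite big_nil; rewrite big_nil Rintegral_prob_cst.
under eq_Rintegral do rewrite big_cons; rewrite big_cons -IH.
by rewrite RintegralD//; apply: bounded_ge0_integrable => //; exact: bounded_ge0_sum.
Qed.

(** * Expectations of functions of block sums *)

Section block_sums.
Context d (T : measurableType d) (R : realType) (Q : probability T R).
Context (w : T -> R) (mw : measurable_fun setT w).
Context dO (Omega : measurableType dO) (P : probability Omega R).

Section family.
Context (I : finType) (Z : I -> Omega -> T) (iid : iid_family P Z Q).

Lemma measurable_block_sum (s : seq I) :
  measurable_fun setT (fun om => \sum_(k <- s) w (Z k om)).
Proof.
apply: measurable_sum => k; apply: measurableT_comp => //.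
exact: (measurable_iid iid).
Qed.

Lemma indep_of_add k (J : {set I}) (X Y : Omega -> R) :
  measurable_fun setT X -> measurable_fun setT Y -> k \notin J ->
  indep_of Q P Z (fun om => (X om, Y om)) (k |: J)%SET ->
  indep_of Q P Z (fun om => (X om, Y om + w (Z k om))) J.
Proof.
move=> mX mY kJ iXY.
have mXY : measurable_fun setT (fun om => (X om, Y om)).
  exact: measurable_fun_pair.
pose g (p : (R * R) * T) := (p.1.1, p.1.2 + w p.2).
apply: (indep_of_comp (g := g) _ (indep_of_pair iid mXY kJ iXY)).
apply: measurable_fun_pair.
  by do 2 apply: measurableT_comp => //.
apply: measurable_funD; first by do 2 apply: measurableT_comp => //.
exact: measurableT_comp.
Qed.

Lemma indep_of_block_sum (s : seq I) (J : {set I}) (X Y : Omega -> R) :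
  measurable_fun setT X -> measurable_fun setT Y ->
  uniq s -> {in s, forall k, k \notin J} ->
  indep_of Q P Z (fun om => (X om, Y om)) ([set k in s] :|: J)%SET ->
  indep_of Q P Z (fun om => (X om, Y om + \sum_(k <- s) w (Z k om))) J.
Proof.
elim: s Y => [|k s IH] Y mX mY.
  move=> _ _; rewrite (_ : (_ :|: J)%SET = J); last first.
    by apply/setP => k; rewrite !inE.
  rewrite (_ : (fun om => _) = (fun om => (X om, Y om + \sum_(k <- [::]) w (Z k om))))//.
  by apply/funext => om; rewrite big_nil addr0.
move=> /= /andP[ks us] sJ iXY.
rewrite (_ : (fun om => _) =
    (fun om => (X om, (Y om + w (Z k om)) + \sum_(k <- s) w (Z k om)))); last first.
  by apply/funext => om; rewrite big_cons addrA.
apply: IH => //.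
- apply: measurable_funD => //; apply: measurableT_comp => //.
  exact: (measurable_iid iid).
- by move=> k' k's; apply: sJ; rewrite inE k's orbT.
apply: indep_of_add => //.
  by rewrite !inE negb_or ks sJ// inE eqxx.
rewrite (_ : (k |: _)%SET = ([set k0 in k :: s] :|: J)%SET)//.
by apply/setP => k'; rewrite !inE orbA.
Qed.

(** Integrating out one summand applies [smooth] once. The factor [h1 (X om)] is carried along so
    that products over two blocks are covered. *)
Lemma integral_block_sum (s : seq I) (X Y : Omega -> R) (h1 h2 : R -> R) :
  measurable_fun setT X -> measurable_fun setT Y -> uniq s ->
  indep_of Q P Z (fun om => (X om, Y om)) [set k in s]%SET ->
  bounded_ge0 h1 -> bounded_ge0 h2 ->
  \int[P]_om (h1 (X om) * h2 (Y om + \sum_(k <- s) w (Z k om))) =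
  \int[P]_om (h1 (X om) * iter (size s) (smooth Q w) h2 (Y om)).
Proof.
move=> mX; elim: s Y => [|k s IH] Y mY.
  by move=> *; under eq_Rintegral do rewrite big_nil addr0.
move=> /= /andP[ks us] iXY b1 b2.
have kE : [set k0 in k :: s]%SET = (k |: [set k0 in s])%SET.
  by apply/setP => k'; rewrite !inE.
rewrite kE in iXY.
have kns : k \notin [set k0 in s]%SET by rewrite inE.
under eq_Rintegral do rewrite big_cons addrA.
(* The tail of the list is integrated out first, with [w (Z k om)] absorbed into [Y]; [Z k] itself
   comes last. *)
rewrite (IH (fun om => Y om + w (Z k om)))//; last 2 first.
- apply: measurable_funD => //; apply: measurableT_comp => //.
  exact: (measurable_iid iid).
- exact: indep_of_add.
set F := iter (size s) (smooth Q w) h2.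
have bF : bounded_ge0 F by exact: bounded_ge0_iter_smooth.
pose h (p : (R * R) * T) := h1 p.1.1 * F (p.1.2 + w p.2).
have mXY : measurable_fun setT (fun om => (X om, Y om)).
  exact: measurable_fun_pair.
rewrite (indep_of_integral (h := h) iid mXY kns iXY)/=; last first.
  apply: bounded_ge0M; apply: bounded_ge0_comp => //.
    by do 2 apply: measurableT_comp => //.
  apply: measurable_funD; first by do 2 apply: measurableT_comp => //.
  exact: measurableT_comp.
apply: eq_Rintegral => om _; rewrite /h/= RintegralZl//.
exact: smooth_integrable.
Qed.

End family.

Section blocks.
Context (M n : nat) (Z : 'I_M * 'I_n -> Omega -> T) (iid : iid_family P Z Q).

Definition block_sum (m : 'I_M) (om : Omega) : R := \sum_(j < n) w (Z (m, j) om).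

Let blk (m : 'I_M) : seq ('I_M * 'I_n) := [seq (m, j) | j <- enum 'I_n].

Let blkE m om : \sum_(k <- blk m) w (Z k om) = block_sum m om.
Proof. by rewrite /blk big_map big_enum. Qed.

Let blk_uniq m : uniq (blk m).
Proof. by rewrite map_inj_uniq ?enum_uniq// => i j []. Qed.

Let blk_size m : size (blk m) = n.
Proof. by rewrite size_map size_enum_ord. Qed.

Let smoothn h := iter n (smooth Q w) h.

Lemma measurable_block (m : 'I_M) : measurable_fun setT (block_sum m).
Proof.
rewrite (_ : block_sum m = fun om => \sum_(k <- blk m) w (Z k om)).
  exact: (measurable_block_sum iid).
by apply/funext => om; rewrite blkE.
Qed.

Lemma integral_block m h : bounded_ge0 h ->
  \int[P]_om h (block_sum m om) = smoothn h 0.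
Proof.
move=> bh.
have b1 : bounded_ge0 (fun _ : R => 1 : R) by split => //; exists 1 => _; rewrite ler01 lexx.
have := @integral_block_sum _ _ iid (blk m) (fun=> 0) (fun=> 0) (fun=> 1) h
  (measurable_cst _) (measurable_cst _) (blk_uniq m) (indep_of_cst iid _ _) b1 bh.
rewrite blk_size.
under eq_Rintegral do rewrite mul1r add0r blkE.
by under [in RHS]eq_Rintegral do rewrite mul1r; rewrite Rintegral_prob_cst.
Qed.

Lemma integral_block2 m m' h : m != m' -> bounded_ge0 h ->
  \int[P]_om (h (block_sum m om) * h (block_sum m' om)) = (smoothn h 0) ^+ 2.
Proof.
move=> mm' bh.
(* Block [m] is accumulated in the second component, with the disjoint block [m'] in reserve; [i2]
   then moves it to the first component, where it stays fixed while block [m'] is integrated out. *)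
have i1 : indep_of Q P Z (fun om => (0 : R, 0 + \sum_(k <- blk m) w (Z k om)))
    [set k in blk m']%SET.
  apply: (indep_of_block_sum iid (X := fun=> 0) (Y := fun=> 0)) => //.
    move=> _ /mapP[j _ ->]; rewrite inE; apply/mapP => -[j' _ [e _]].
    by rewrite e eqxx in mm'.
  exact: (indep_of_cst iid ((0 : R), (0 : R))%type).
have i2 : indep_of Q P Z (fun om => (block_sum m om, 0 : R)) [set k in blk m']%SET.
  rewrite (_ : (fun om => _) = (fun p : R * R => (p.2, 0 : R)) \o
    (fun om => (0 : R, 0 + \sum_(k <- blk m) w (Z k om)))); last first.
    by apply/funext => om /=; rewrite add0r blkE.
  apply: (indep_of_comp _ i1).
  by apply: measurable_fun_pair => //; exact: measurable_snd.
have := integral_block_sum iid (measurable_block m) (measurable_cst _)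
  (blk_uniq m') i2 bh bh.
rewrite blk_size.
under eq_Rintegral do rewrite add0r blkE.
move=> ->; rewrite /= RintegralZr//; last first.
  by apply: bounded_ge0_integrable; apply: bounded_ge0_comp => //; exact: measurable_block.
by rewrite integral_block.
Qed.

End blocks.
End block_sums.

(** * Signal-to-noise ratio *)

Lemma Rintegral_block_variance d (T : measurableType d) (R : realType)
    (Q : probability T R) (w : T -> R) (mw : measurable_fun setT w)
    dO (Omega : measurableType dO)
    (P : probability Omega R) (M n : nat) (Z : 'I_M * 'I_n -> Omega -> T)
    (iid : iid_family P Z Q) (h : R -> R) (bh : bounded_ge0 h) :
  let a := iter n (smooth Q w) h 0 in
  let b := iter n (smooth Q w) (fun x => h x ^+ 2) 0 in
  let G := fun om => \sum_(m < M) h (block_sum w Z m om) in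
  \int[P]_om G om = M%:R * a /\
  \int[P]_om (G om - M%:R * a) ^+ 2 = M%:R * (b - a ^+ 2).
Proof.
move=> a b G.
have bS m : bounded_ge0 (fun om => h (block_sum w Z m om)).
  by apply: bounded_ge0_comp => //; exact: (measurable_block mw iid).
have bG : bounded_ge0 G by exact: bounded_ge0_sum.
have EG : \int[P]_om G om = M%:R * a.
  rewrite Rintegral_sum// (eq_bigr (fun=> a)) => [|m _]; last first.
    by rewrite (integral_block mw iid).
  by rewrite sumr_const card_ord mulr_natl.
split => //.
rewrite Rintegral_sqr_dev// EG.
rewrite (@eq_Rintegral _ _ _ P _ (fun om => \sum_(m < M) \sum_(m' < M)
    (h (block_sum w Z m om) * h (block_sum w Z m' om)))); last first.
  by move=> om _; rewrite expr2 big_distrlr.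
rewrite Rintegral_sum => [|m]; last first.
  by apply: bounded_ge0_sum => m'; exact: bounded_ge0M.
(* Each row of the double sum counts [a ^+ 2] for every [m'], corrected by [b - a ^+ 2] at the
   diagonal entry. *)
rewrite (eq_bigr (fun=> M%:R * a ^+ 2 + (b - a ^+ 2))) => [|m _]; last first.
  rewrite Rintegral_sum => [|m']; last exact: bounded_ge0M.
  rewrite (eq_bigr (fun m' => a ^+ 2 + (if m' == m then b - a ^+ 2 else 0))).
    rewrite big_split/= sumr_const card_ord mulr_natl.
    by rewrite -big_mkcond big_pred1_eq.
  move=> m' _; case: eqVneq => [->|mm'].
    rewrite addrC subrK; apply: (integral_block (h := fun x => h x ^+ 2) mw iid m).
    exact: bounded_ge0_sqr.
  by rewrite addr0 (integral_block2 mw iid)// eq_sym.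
rewrite sumr_const card_ord -mulr_natl; ring.
Qed.

(** With [N = n.+1] summands, the variance is of order at most [N ^- 5] and the squared mean of
    order at least [N ^- 4]; the factor [n.+2], which is K, makes up for the difference. *)
Lemma block_snr_bound d (T : measurableType d) (R : realType)
    (Q : probability T R) (w : T -> R) (a : R) (n : nat) :
  measurable_fun setT w -> (forall y, 0 <= w y) ->
  {ae Q, forall y, 0 < w y} -> 0 < a ->
  Q.-integrable setT (EFin \o w) ->
  Q.-integrable setT (EFin \o (fun y => w y ^+ 2)) ->
  Q.-integrable setT (EFin \o (fun y => w y ^- 6)) ->
  let mu := \int[Q]_y w y in
  let B := 4 * \int[Q]_y (w y ^+ 2) * (a ^- 6 + \int[Q]_y (w y ^- 6)) in
  n.+2%:R * (iter n.+1 (smooth Q w) (fun x => invpow a 2 x ^+ 2) 0 -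
             (iter n.+1 (smooth Q w) (invpow a 2) 0) ^+ 2)
    <= (2 * B + 1) * (mu + a) ^+ 4 *
       (iter n.+1 (smooth Q w) (invpow a 2) 0) ^+ 2.
Proof.
move=> mw w_ge0 w_gt0 a0 i1 i2 i6; cbv zeta; set mu := \int[Q]_y w y.
have := iter_smooth_variance_le mw w_ge0 a0 n i2 (lexx 0).
(* Taking [m = 1] and [s = 0] lets [a] count as one summand, giving the denominator [n.+1 ^ 7]. *)
have := iter_smooth_inv_pow6_le mw w_ge0 a0 n i6 w_gt0 ltr01 (lexx 0).
have := iter_smooth_inv_sqr_ge mw w_ge0 a0 n.+1 i1 (lexx 0).
rewrite !add0r expr1n mul1r -/mu nat1r.
have mu0 : 0 <= mu by apply: Rintegral_ge0 => y _.
have ka0 : 0 <= \int[Q]_y (w y ^- 6).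
  by apply: Rintegral_ge0 => y _; rewrite invr_ge0 exprn_ge0.
have m20 : 0 <= \int[Q]_y (w y ^+ 2).
  by apply: Rintegral_ge0 => y _; rewrite exprn_ge0.
move: mu0 ka0 m20.
set k := \int[Q]_y (w y ^- 6); set m2 := \int[Q]_y (w y ^+ 2).
set x := iter n.+1 _ _ 0; set y := iter n.+1 _ _ 0; set z := iter n _ _ 0.
move=> mu0 ka0 m20 Hx Hz Hy.
have n0 : 0 < n.+1%:R :> R by rewrite ltr0n.
have n1 : 1 <= n.+1%:R :> R by rewrite ler1n.
have nE : n%:R = n.+1%:R - 1 :> R by rewrite -natr1 addrK.
rewrite -[n.+2%:R]natr1.
move: n0 n1 nE Hx Hz Hy; move: n.+1%:R => N n0 n1 nE Hx Hz Hy.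
have a6 : 0 <= a ^- 6 by rewrite invr_ge0 exprn_ge0// ltW.
have {}Hz : z <= (a ^- 6 + k) * N ^- 6.
  apply: (le_trans Hz).
  rewrite (_ : _ * N ^- 6 = (a ^- 6 + k) * N / N ^+ 7); last first.
    by field; rewrite !gt_eqF.
  rewrite ler_pM2r ?invr_gt0 ?exprn_gt0//.
  rewrite nE; nra.
have var : y - x ^+ 2 <= 4 * m2 * (a ^- 6 + k) * N ^- 5.
  rewrite lerBlDl; apply: (le_trans Hy); rewrite lerD2l.
  apply: (le_trans (ler_wpM2l _ Hz)); first by rewrite !mulr_ge0 ?(ltW n0)//; lra.
  rewrite le_eqVlt; apply/orP; left; apply/eqP; field.
  by rewrite !gt_eqF.
(* Since [1 <= N], [N * mu + a <= N * (mu + a)], and the lower bound on the mean is squared. *)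
have low : N ^- 4 <= (mu + a) ^+ 4 * x ^+ 2.
  have ma0 : 0 < mu + a by rewrite ltr_wpDl.
  have nma0 : 0 < N * mu + a by rewrite ltr_wpDl// mulr_ge0// ltW.
  have : N ^- 2 <= (mu + a) ^+ 2 * x.
    apply: le_trans (ler_wpM2l (sqr_ge0 _) Hx).
    rewrite ler_pdivlMr ?exprn_gt0// mulrC ler_pdivrMr ?exprn_gt0//.
    rewrite -exprMn lerXn2r// ?nnegrE ?(ltW nma0) ?mulr_ge0 ?(ltW ma0) ?(ltW n0)//.
    by rewrite mulrDl [mu * _]mulrC lerD2l ler_peMr// ltW.
  move=> /(lerXn2r 2); rewrite !nnegrE invr_ge0 exprn_ge0 ?(ltW n0)//.
  rewrite mulr_ge0 ?sqr_ge0//=; last first.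
    by apply: le_trans Hx; rewrite invr_ge0 sqr_ge0.
  by move=> /(_ isT isT); rewrite exprVn -exprM exprMn -exprM.
have B0 : 0 <= 4 * m2 * (a ^- 6 + k) by rewrite !mulr_ge0// addr_ge0.
move: var B0; set B' := 4 * m2 * _ => var B0.
apply: (@le_trans _ _ ((2 * B' + 1) * N ^- 4)); last first.
  by rewrite -mulrA ler_wpM2l// addr_ge0// mulr_ge0.
apply: (@le_trans _ _ ((N + 1) * (B' * N ^- 5))).
  by rewrite ler_wpM2l//; lra.
(* The factor 2 in the constant comes from [N + 1 <= 2 * N]. *)
apply: (@le_trans _ _ (2 * N * (B' * N ^- 5))).
  have BN0 : 0 <= B' * N ^- 5 by rewrite mulr_ge0// invr_ge0 exprn_ge0 ?(ltW n0).
  by rewrite ler_wpM2r//; lra.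
rewrite (_ : _ * (B' * _) = 2 * B' * N ^- 4); last first.
  by field; rewrite gt_eqF.
by rewrite ler_wpM2r ?invr_ge0 ?exprn_ge0 ?(ltW n0)// lerDl.
Qed.

(** The mass of the zero set of [q] is the integral of [q] over it. Positivity of the weight can
    fail only there, where division by 0 makes it 0. *)
Lemma has_density_neq0 (R : realType) d (Q : probability (d.-tuple R) R)
    (q : d.-tuple R -> R) : measurable_fun setT q -> has_density Q q ->
  {ae Q, forall y, 0 < q y}.
Proof.
move=> mq [q0 dens].
exists [set y | q y = 0]; split.
- rewrite -[X in measurable X]setTI; exact: (mq measurableT [set 0]).
- rewrite dens; last by rewrite -[X in measurable X]setTI; exact: (mq measurableT [set 0]).
  rewrite (_ : (fun _ => _) = fun=> 0%:E).
    elim: d {Q q mq q0 dens} => //= d IH.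
    under eq_integral do rewrite IH; exact: integral0.
  apply/funext => y; rewrite indicE; case: (boolP (y \in _)); last by rewrite mul0r.
  by rewrite inE/= => ->; rewrite mulr0.
- by move=> y /= /negP; rewrite -leNgt => qy; apply/eqP; rewrite eq_le qy q0.
Qed.

(** This derives the moments of order 1, 2 and -6 from those of order 4 and -12. *)
Lemma integrable_le1D d (T : measurableType d) (R : realType)
    (Q : probability T R) (f g : T -> R) :
  measurable_fun setT f -> measurable_fun setT g ->
  (forall y, 0 <= f y <= 1 + g y) -> (forall y, 0 <= g y) ->
  (\int[Q]_y (g y)%:E < +oo)%E -> Q.-integrable setT (EFin \o f).
Proof.
move=> mf mg fg g0 goo.
have ig : Q.-integrable setT (EFin \o g).
  apply/integrableP; split; first exact/measurable_EFinP.
  by under eq_integral do rewrite /= ger0_norm//.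
have i1g := integrable_EFinD (integrable_EFin_cst Q 1) ig.
apply: (le_integrable measurableT _ _ i1g); first exact/measurable_EFinP.
move=> y _; have /andP[f0 f1] := fg y.
by rewrite lee_fin !ger0_norm// addr_ge0.
Qed.

Lemma fine_expectationE dO (Omega : measurableType dO) (R : realType)
    (P : probability Omega R) (X : Omega -> R) :
  fine 'E_P[X] = \int[P]_om X om.
Proof. by rewrite unlock. Qed.

Lemma fine_varianceE dO (Omega : measurableType dO) (R : realType)
    (P : probability Omega R) (X : Omega -> R) :
  fine 'V_P[X] = \int[P]_om (X om - \int[P]_om X om) ^+ 2.
Proof.
rewrite /variance unlock !fine_expectationE.
by apply: eq_Rintegral => om _; rewrite expr2.
Qed.

Unset Implicit Arguments.

Theorem theorem1 (R : realType) (d : nat)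
    (px : d.-tuple R -> R)            (* z |-> p(x,z), x fixed *)
    (q : d.-tuple R -> R)             (* density of the proposal *)
    (Q : probability (d.-tuple R) R)  (* law with density q *)
    (z : d.-tuple R) (i : 'I_d) :
  (forall y, 0 < px y) ->
  measurable_fun setT px ->
  (forall v : 'rV[R]_d, differentiable (fun u => px (rv2t u)) v) ->
  measurable_fun setT q ->
  has_density Q q ->
  (\int[Q]_y ((weight px q y) ^+ 4)%:E < +oo)%E ->
  (\int[Q]_y ((weight px q y) ^- 12)%:E < +oo)%E ->
  0 < weight px q z ->
  exists C : R, 0 < C /\ exists K0 : nat,
    forall K M : nat, (K0 <= K)%N -> (1 <= M)%N ->
    forall (dO : measure_display) (Omega : measurableType dO)
           (P : probability Omega R)
           (Z : 'I_M * 'I_K.-1 -> Omega -> d.-tuple R),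
    iid_family P Z Q ->
    let g := estimator i px q z Z in
    C * Num.sqrt (M * K)%:R * Num.sqrt (fine 'V_P[g]) <= `|fine 'E_P[g]|.
Proof.
move=> px0 mpx _ mq dens w4 w12 a0.
have [q0 _] := dens.
set w := weight px q in w4 w12 a0 *.
set a := w z in a0 *.
have mw : measurable_fun setT w by exact: (measurable_funM mpx (measurable_funV mq)).
have w_ge0 y : 0 <= w y by rewrite /w /weight divr_ge0// ltW.
have w_gt0 : {ae Q, forall y, 0 < w y}.
  apply: filterS (has_density_neq0 mq dens) => y qy.
  by rewrite /w /weight divr_gt0.
have mw6 : measurable_fun setT (fun y => w y ^- 6).
  exact/measurable_funV/measurable_funX.
have w4_ge0 y : 0 <= w y ^+ 4 by exact: exprn_ge0.
have i1 : Q.-integrable setT (EFin \o w).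
  apply: (@integrable_le1D _ _ _ _ _ (fun y => w y ^+ 4)) => //.
    exact: measurable_funX.
  move=> y; rewrite w_ge0/=; have := w_ge0 y; move: (w y) => t t0.
  (* The squares give [t <= t ^+ 2 + 1 / 4 <= t ^+ 4 + 1 / 2]. *)
  by have := sqr_ge0 (t ^+ 2 - 1 / 2); have := sqr_ge0 (t - 1 / 2); nra.
have i2 : Q.-integrable setT (EFin \o (fun y => w y ^+ 2)).
  apply: (@integrable_le1D _ _ _ _ _ (fun y => w y ^+ 4)) => //.
  - exact: measurable_funX.
  - exact: measurable_funX.
  - move=> y; rewrite sqr_ge0/=; move: (w y) => t.
    by have := sqr_ge0 (t ^+ 2 - 1 / 2); nra.
have i6 : Q.-integrable setT (EFin \o (fun y => w y ^- 6)).
  apply: (@integrable_le1D _ _ _ _ _ (fun y => w y ^- 12)) => //.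
  - exact/measurable_funV/measurable_funX.
  - move=> y; rewrite invr_ge0 exprn_ge0//=.
    rewrite (_ : w y ^- 12 = (w y ^- 6) ^+ 2); last first.
      by rewrite exprVn -exprM.
    by move: (w y ^- 6) => t; have := sqr_ge0 (t - 1 / 2); nra.
  - by move=> y; rewrite invr_ge0 exprn_ge0.
pose mu := \int[Q]_y w y.
pose B := 4 * \int[Q]_y (w y ^+ 2) * (a ^- 6 + \int[Q]_y (w y ^- 6)).
have mu0 : 0 <= mu by apply: Rintegral_ge0 => y _.
have B0 : 0 <= B.
  rewrite mulr_ge0 ?mulr_ge0// ?addr_ge0// ?invr_ge0 ?exprn_ge0 ?(ltW a0)//.
    by apply: Rintegral_ge0 => y _; exact: sqr_ge0.
  by apply: Rintegral_ge0 => y _; rewrite invr_ge0 exprn_ge0.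
(* [L] bounds K times variance over squared mean for one block, whence the witness [L^-1] under the
   root. The added 1 makes [L] positive from [0 <= B] alone. *)
pose L := (2 * B + 1) * (mu + a) ^+ 4.
have L0 : 0 < L by rewrite mulr_gt0 ?exprn_gt0//; lra.
exists (Num.sqrt L^-1); split; first by rewrite sqrtr_gt0 invr_gt0.
(* With [K = n.+2], each block has [n.+1] summands, at least one. *)
exists 2%N => K M; case: K => [//|[//|n]] _ M1 dO Omega P Z iid.
cbv zeta; rewrite [_.-1]/= in Z iid *; set g := estimator _ _ _ _ _.
(* [D] may vanish; in the product form of the inequality both sides are then 0. *)
pose D := partial i (fun y => ln (w y)) z.
pose c := M%:R^-1 * a ^+ 2 * D.
pose G om := \sum_(m < M) invpow a 2 (block_sum w Z m om).
have gE om : g om = c * G om.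
  rewrite /g /estimator /c /G -!(mulrA M%:R^-1); congr (_ * _).
  rewrite mulr_sumr; apply: eq_bigr => m _.
  rewrite -/w -/a -/D /invpow ger0_norm; last by apply: sumr_ge0.
  by rewrite /block_sum expr_div_n mulrAC.
have ba := bounded_ge0_invpow 2 a0.
have [EG VG] := Rintegral_block_variance mw iid ba.
have := block_snr_bound n mw w_ge0 w_gt0 a0 i1 i2 i6.
cbv zeta; rewrite -/mu -/B -/L.
move: EG VG; rewrite -/G.
set x := iter _ _ (invpow a 2) 0; set y := iter _ _ _ 0.
move=> EG VG; clearbody x y => xy.
have bG : bounded_ge0 G.
  apply: bounded_ge0_sum => m; apply: bounded_ge0_comp => //.
  exact: (measurable_block mw iid).
have Eg : \int[P]_om g om = c * (M%:R * x).
  under eq_Rintegral do rewrite gE.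
  by rewrite RintegralZl// ?EG//; exact: bounded_ge0_integrable.
have Vg : \int[P]_om (g om - c * (M%:R * x)) ^+ 2 = c ^+ 2 * (M%:R * (y - x ^+ 2)).
  rewrite -VG -RintegralZl//; last exact: (integrable_sqr_dev P (M%:R * x) bG).
  by apply: eq_Rintegral => om _; rewrite gE -mulrBr exprMn.
rewrite fine_varianceE fine_expectationE Eg Vg.
rewrite -!sqrtrM ?mulr_ge0 ?invr_ge0 ?(ltW L0)// -sqrtr_sqr.
apply: ler_wsqrtr; rewrite natrM.
(* Under the roots, the factor M of the claim and the M of the variance of [G] combine to match the
   squared mean; only the single-block bound remains. *)
rewrite (_ : _ * (c ^+ 2 * _) =
  (c * M%:R) ^+ 2 * (L^-1 * (n.+2%:R * (y - x ^+ 2)))); last by ring.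
by rewrite (mulrA c) [leRHS]exprMn ler_wpM2l ?sqr_ge0// ler_pdivrMl.
Qed.
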